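(* For $k\ge1$ let $t_n^k(213)$ be the number of permutations $\pi\in\mathcal{S}_n$ such that $\pi,\theta(\pi),\theta^2(\pi),\dots,\theta^k(\pi)$ all avoid $213$. Then for $n\geq 5$: $t_n^3(213)=2n+1$, $t_n^4(213)=n+4$, and $t_n^k(213)=7$ for every $k\geq 5$.
   Context: $\mathcal{S}_n$ is the symmetric group on $[n]$, permutations in one-line notation $\pi_1\cdots\pi_n$. A permutation avoids a pattern $\tau$ if it has no subsequence order-isomorphic to $\tau$. The standard cycle notation of $\pi$ writes each cycle (fixed points included) with its largest element first and orders cycles by increasing largest element. The fundamental bijection $\theta:\mathcal{S}_n\to\mathcal{S}_n$ maps $\pi$ to the permutation whose one-line notation is obtained by erasing the parentheses of the standard cycle notation of $\pi$; $\theta^k$ denotes its $k$-fold composition. *)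

(* Defs.v *)
From mathcomp Require Import all_boot fingroup perm.

Set Implicit Arguments.
Unset Strict Implicit.
Unset Printing Implicit Defensive.

(* Permutations of [n] are elements of 'S_n, i.e. they act on {0, .., n-1}
   rather than {1, .., n}. *)

Definition one_line (n : nat) (s : 'S_n) : seq 'I_n :=
  [seq s i | i <- enum 'I_n].

Definition order_iso (u v : seq nat) : bool :=
  (size u == size v) &&
  all (fun i => all (fun j =>
         (nth 0 u i < nth 0 u j) == (nth 0 v i < nth 0 v j))
       (iota 0 (size u))) (iota 0 (size u)).

(* The subsequences of the word of s are its images under bit masks. *)
Definition contains (tau : seq nat) (n : nat) (s : 'S_n) : bool :=
  [exists m : n.-tuple bool,
     order_iso (mask m (map (@nat_of_ord n) (one_line s))) tau].

Definition avoids (tau : seq nat) (n : nat) (s : 'S_n) : bool :=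
  ~~ contains tau s.

(* enum 'I_n is increasing, so cycle maxima come in increasing order. *)
Definition cycle_maxima (n : nat) (s : 'S_n) : seq 'I_n :=
  [seq m : 'I_n <- enum 'I_n | all (fun j : 'I_n => j <= m) (fingraph.orbit s m)].

(* fingraph.orbit s m is the list [:: m; s m; s (s m); ...] of the cycle of m. *)
Definition std_cycles (n : nat) (s : 'S_n) : seq (seq 'I_n) :=
  [seq fingraph.orbit s m | m <- cycle_maxima s].

Definition theta_word (n : nat) (s : 'S_n) : seq 'I_n := flatten (std_cycles s).

Lemma mem_theta_word (n : nat) (s : 'S_n) (x : 'I_n) : x \in theta_word s.
Proof.
have xx : fconnect s x x by exact: connect0.
pose m := [arg max_(j > x | fconnect s x j) (j : nat)].
have [xm maxm] : fconnect s x m /\ forall j, fconnect s x j -> j <= m.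
  by rewrite /m; case: arg_maxnP.
apply/flattenP; exists (fingraph.orbit s m).
  apply: map_f; rewrite mem_filter mem_enum andbT; apply/allP=> j.
  by rewrite -fconnect_orbit => mj; apply: maxm; apply: connect_trans mj.
by rewrite -fconnect_orbit fconnect_sym //; exact: perm_inj.
Qed.

Lemma theta_word_uniq (n : nat) (s : 'S_n) : uniq (theta_word s).
Proof.
have sI : injective s by exact: perm_inj.
have : uniq (cycle_maxima s) by rewrite filter_uniq // enum_uniq.
have : all [pred m : 'I_n | all (fun j : 'I_n => j <= m) (fingraph.orbit s m)]
         (cycle_maxima s) by exact: filter_all.
rewrite /theta_word /std_cycles; elim: (cycle_maxima s) => //= m r IHr.
case/andP=> maxm maxr /andP[mr ur].
rewrite cat_uniq orbit_uniq IHr // andbT; apply/hasPn=> x /flattenP[c].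
case/mapP=> m' m'r ->{c} m'x; apply/negP=> mx.
have mm' : fconnect s m m'.
  rewrite -fconnect_orbit in m'x; rewrite /= -fconnect_orbit in mx.
  by apply: connect_trans mx _; rewrite fconnect_sym.
have le1 : m' <= m by apply: (allP maxm); rewrite -fconnect_orbit.
have le2 : m <= m'.
  have /= /allP := allP maxr _ m'r; apply.
  by rewrite -fconnect_orbit fconnect_sym.
suff E : m = m' by rewrite E m'r in mr.
by apply/val_inj/eqP; rewrite eqn_leq le1 le2.
Qed.

Lemma size_theta_word (n : nat) (s : 'S_n) : size (theta_word s) = n.
Proof.
rewrite -(card_uniqP (theta_word_uniq s)) -[RHS](card_ord n).
by apply: eq_card => x; rewrite mem_theta_word.
Qed.

(* The default value i of nth is never used, by size_theta_word. *)
Definition theta_fun (n : nat) (s : 'S_n) (i : 'I_n) : 'I_n :=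
  nth i (theta_word s) i.

Lemma theta_fun_inj (n : nat) (s : 'S_n) : injective (theta_fun s).
Proof.
move=> i j; rewrite /theta_fun (set_nth_default j i) ?size_theta_word //.
move/eqP; rewrite nth_uniq ?size_theta_word ?theta_word_uniq //.
by move/eqP/val_inj.
Qed.

Definition theta (n : nat) (s : 'S_n) : 'S_n := perm (@theta_fun_inj n s).

Lemma one_line_theta (n : nat) (s : 'S_n) : one_line (theta s) = theta_word s.
Proof.
case: n s => [|n] s.
  by rewrite [LHS]size0nil ?[RHS]size0nil // ?size_theta_word // size_map
    size_enum_ord.
apply: (@eq_from_nth _ ord0).
  by rewrite size_map size_enum_ord size_theta_word.
move=> i; rewrite size_map size_enum_ord => lt_i.
rewrite (nth_map ord0) ?size_enum_ord // permE /theta_fun nth_enum_ord //.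
by apply: set_nth_default; rewrite size_theta_word.
Qed.

Definition t_count (tau : seq nat) (k n : nat) : nat :=
  #|[set s : 'S_n | [forall j : 'I_k.+1, avoids tau (iter j (@theta n) s)]]|.

(* Main.v *)
(** Let N = n - 1. A permutation fixing 0 is a lift of one of size n - 1, and
    lifting commutes with theta and preserves avoidance of 213; so it suffices
    to count, for n >= 5, the permutations s with s 0 <> 0 in each chain, and to
    settle n = 4 by computation.

    If theta s avoids 213, then s has at most one nontrivial cycle, and that
    cycle contains N: the maximum m < N of another nontrivial cycle would give
    the pattern m, s m, N in theta s. Hence the word of theta s is the increasing
    list of the fixed points of s below N, followed by N, s N, s (s N), ... .
    Comparing the patterns forced in s, theta s, theta^2 s and theta^3 s shows
    that s 0 <> 0 leaves only s = (0 N) and its preimage under theta, whose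
    orbit is, in one-line notation,
      N 2 3 .. N-1 0 1  ->  N 1 2 .. N-1 0  ->  1 2 .. N 0
        ->  N 0 1 .. N-1  ->  N N-1 .. 1 0,
    and the next word contains 213. *)

Require Import Defs.
From mathcomp Require Import all_boot fingroup perm zify.

Set Implicit Arguments.
Unset Strict Implicit.
Unset Printing Implicit Defensive.

Local Notation p213 := [:: 2; 1; 3].

(** * Patterns 213 located by positions and by values *)

Lemma subseq_enum_ord (n : nat) (i j k : 'I_n) :
  i < j -> j < k -> subseq [:: i; j; k] (enum 'I_n).
Proof.
move=> ij jk.
have sE : sorted (relpre val ltn) (enum 'I_n).
  by rewrite -(sorted_map (f := val)) val_enum_ord iota_ltn_sorted.
have <- : [seq x <- enum 'I_n | x \in [:: i; j; k]] = [:: i; j; k].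
  apply: (@irr_sorted_eq _ (relpre val ltn)).
  - by move=> y x z /=; apply: ltn_trans.
  - by move=> x /=; rewrite ltnn.
  - by apply: sorted_filter => // y x z /=; apply: ltn_trans.
  - by rewrite /= ij jk.
  - by move=> x; rewrite mem_filter mem_enum andbT.
exact: filter_subseq.
Qed.

Lemma avoids213P (n : nat) (s : 'S_n) :
  reflect (forall i j k : 'I_n, i < j -> j < k -> s j < s i -> ~~ (s i < s k))
          (avoids p213 s).
Proof.
apply: (iffP negP) => [av i j k ij jk sji|av].
  apply/negP => sik; apply: av; apply/existsP.
  have /subseqP[m sm Em] := subseq_enum_ord ij jk.
  have sm' : size m == n by rewrite sm size_enum_ord.
  exists (Tuple sm'); rewrite /one_line -2!map_mask.
  rewrite -[mask _ _]/(mask m (enum 'I_n)) -Em /order_iso /=.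
  lia.
case/existsP=> m; rewrite /one_line -2!map_mask.
have : sorted (relpre val ltn) (mask m (enum 'I_n)).
  apply: (@subseq_sorted _ _ _ _ (enum 'I_n)).
  - by move=> y x z /=; apply: ltn_trans.
  - exact: mask_subseq.
  - by rewrite -(sorted_map (f := val)) val_enum_ord iota_ltn_sorted.
case: (mask m _) => [|i [|j [|k [|? ?]]]] //= /and3P[ij jk _].
rewrite /order_iso /= => H.
by have := av i j k ij jk; lia.
Qed.

(** The pattern is given by its letters rather than its places: for a permutation [theta s], cycles
    determine which letter precedes which, and the inverse gives the positions. *)
Lemma avoids213_pos (n : nat) (s : 'S_n) (x y z : 'I_n) :
  avoids p213 s -> (s^-1)%g x < (s^-1)%g y -> (s^-1)%g y < (s^-1)%g z ->
  y < x -> x < z -> False.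
Proof.
move=> /avoids213P av xy yz yx xz.
by have := av _ _ _ xy yz; rewrite !permKV xz => /(_ yx).
Qed.

Lemma thetaV (n : nat) (s : 'S_n) (x : 'I_n) :
  ((theta s)^-1)%g x = index x (theta_word s) :> nat.
Proof.
rewrite -[in RHS](permKV (theta s) x) [X in index X]permE /theta_fun.
by rewrite index_uniq ?size_theta_word ?theta_word_uniq.
Qed.

Lemma orbit_fix (T : finType) (f : T -> T) (x : T) :
  f x = x -> fingraph.orbit f x = [:: x].
Proof.
move=> fx; rewrite /fingraph.orbit; suff -> : fingraph.order f x = 1 by [].
apply: (@order_cycle _ f [:: x]) => //=; first by rewrite fx eqxx.
by rewrite inE.
Qed.

Lemma thetaV_cat (n : nat) (s : 'S_n) (p q : seq 'I_n) (x : 'I_n) :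
  theta_word s = p ++ x :: q -> ((theta s)^-1)%g x = size p :> nat.
Proof.
move=> E; have := theta_word_uniq s; rewrite thetaV E cat_uniq /=.
by case/and3P=> _ /norP[xp _] _; rewrite index_cat (negPf xp) /= eqxx addn0.
Qed.

(** * The word of [theta s] when s has at most one nontrivial cycle *)

Section Theta.

Variable N : nat.
Implicit Types (s : 'S_N.+1) (x y : 'I_N.+1).

(** The identity qualifies; any other such s has a single nontrivial cycle, the one through N. *)
Definition one_cycle s := forall x, s x != x -> fconnect s ord_max x.

Lemma theta_avoids_one_cycle s : avoids p213 (theta s) -> one_cycle s.
Proof.
move=> av x sx; apply/negPn/negP => Nx.
have sI : injective s by exact: perm_inj.
pose m := [arg max_(j > x | fconnect s x j) (j : nat)].
have [xm maxm] : fconnect s x m /\ forall j, fconnect s x j -> j <= m.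
  by rewrite /m; case: arg_maxnP.
have mN : m != ord_max.
  by apply: contraNneq Nx => <-; rewrite fconnect_sym.
have sm : s m != m.
  apply: contraNneq sx => E; move: xm; rewrite fconnect_sym // fconnect_orbit.
  by rewrite orbit_fix // inE => /eqP ->; rewrite E.
have sm_lt : s m < m.
  rewrite ltn_neqAle sm maxm //; apply: connect_trans xm _; exact: fconnect1.
have m_lt : m < N.
  by rewrite ltn_neqAle mN /= -ltnS ltn_ord.
(* The maxima below N are enumerated through ['I_N], so that the cycle of N splits off as the last
   block of the word. *)
have mc : m \in [seq i : 'I_N.+1 <- map (widen_ord (leqnSn N)) (enum 'I_N) |
                 all (fun j : 'I_N.+1 => j <= i) (fingraph.orbit s i)].
  rewrite mem_filter; apply/andP; split.
    apply/allP => j; rewrite -fconnect_orbit => mj; apply: maxm.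
    exact: connect_trans mj.
  apply/mapP; exists (Ordinal m_lt); first by rewrite mem_enum.
  exact: val_inj.
have Nc : all (fun j : 'I_N.+1 => j <= (ord_max : 'I_N.+1))
             (fingraph.orbit s ord_max).
  by apply/allP => j _; rewrite /= -ltnS.
have Ew : theta_word s =
    flatten [seq fingraph.orbit s i | i <-
               [seq i : 'I_N.+1 <- map (widen_ord (leqnSn N)) (enum 'I_N) |
                 all (fun j : 'I_N.+1 => j <= i) (fingraph.orbit s i)]] ++
    fingraph.orbit s ord_max.
  rewrite /theta_word /std_cycles /cycle_maxima enum_ordSr filter_rcons Nc.
  by rewrite map_rcons flatten_rcons.
case/splitPr: mc Ew => c1 c2; rewrite map_cat flatten_cat /= -!catA.
have [k ->] : exists k, fingraph.orbit s m = [:: m, s m & k].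
  rewrite /fingraph.orbit; case E: (fingraph.order s m) => [|[|k]] /=.
  - by have := fingraph.order_gt0 s m; rewrite E.
  - by have := iter_order sI m; rewrite E /= => E'; rewrite E' eqxx in sm.
  - by exists (traject s (s (s m)) k).
have [k' ->] : exists k', fingraph.orbit s ord_max = ord_max :: k'.
  by rewrite /fingraph.orbit -orderSpred; eexists.
(* The word is now a, m, [s m], k, b, N, k', which shows m, [s m], N in this order. *)
set a := flatten _; set b := flatten _ => Ew.
have Em : ((theta s)^-1)%g m = size a :> nat by exact: thetaV_cat Ew.
have Es : ((theta s)^-1)%g (s m) = (size a).+1 :> nat.
  rewrite (@thetaV_cat _ _ (rcons a m) (k ++ b ++ ord_max :: k')) ?size_rcons //.
  by rewrite cat_rcons.
have EN : ((theta s)^-1)%g ord_max = size a + (size k).+2 + size b :> nat.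
  rewrite (@thetaV_cat _ _ (a ++ [:: m, s m & k] ++ b) k') -?catA //.
  by rewrite !size_cat addnA.
by apply: (@avoids213_pos _ (theta s) m (s m) ord_max av) => //; lia.
Qed.

Section OneCycle.

Variable s : 'S_N.+1.
Hypothesis sC : one_cycle s.

Let sI : injective s := @perm_inj _ s.

(** N is left out because, even when fixed, it belongs to the last block
    [fingraph.orbit s ord_max]. *)
Definition small_fixed : seq 'I_N.+1 :=
  [seq i <- enum 'I_N.+1 | (s i == i) && (i != ord_max)].

(** A fixed point is the maximum of its own cycle, while a moved i < N shares its cycle with N and
    so is no cycle maximum. *)
Lemma theta_word_one_cycle :
  theta_word s = small_fixed ++ fingraph.orbit s ord_max.
Proof.
have Nc : all (fun j : 'I_N.+1 => j <= (ord_max : 'I_N.+1))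
             (fingraph.orbit s ord_max).
  by apply/allP => j _; rewrite /= -ltnS.
rewrite /theta_word /std_cycles /cycle_maxima /small_fixed enum_ordSr.
rewrite !filter_rcons Nc eqxx andbF map_rcons flatten_rcons; congr (_ ++ _).
have : all (fun i : 'I_N.+1 => i < N) (map (widen_ord (leqnSn N)) (enum 'I_N)).
  by apply/allP => i /mapP[j _ ->] /=.
elim: (map _ _) => //= i l IHl /andP[iN /IHl {}IHl].
have iN' : i != ord_max by apply: contraTneq iN => ->; rewrite ltnn.
rewrite iN' andbT; case: eqVneq => [si|si].
  by rewrite orbit_fix //= leqnn /= orbit_fix // IHl.
rewrite ifN ?IHl //; apply/allPn; exists ord_max; last by rewrite -ltnNge.
by rewrite -fconnect_orbit fconnect_sym // sC.
Qed.

Let pos x := ((theta s)^-1)%g x.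

Lemma mem_small_fixed f : (f \in small_fixed) = (s f == f) && (f != ord_max).
Proof. by rewrite mem_filter mem_enum andbT. Qed.

Lemma pos_fixed f : s f = f -> f != ord_max -> pos f = index f small_fixed :> nat.
Proof.
move=> sf fN; rewrite thetaV theta_word_one_cycle index_cat mem_small_fixed.
by rewrite sf eqxx fN.
Qed.

Lemma pos_orbit x : fconnect s ord_max x ->
  pos x = size small_fixed + index x (fingraph.orbit s ord_max) :> nat.
Proof.
move=> Nx; rewrite thetaV theta_word_one_cycle index_cat ifN //.
rewrite mem_small_fixed; apply/negP => /andP[/eqP sx xN].
move: Nx; rewrite fconnect_sym // fconnect_orbit orbit_fix // inE eq_sym.
exact/negP.
Qed.

Lemma pos_max_le x : fconnect s ord_max x -> pos ord_max <= pos x.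
Proof.
move=> Nx; rewrite !pos_orbit // leq_add2l /fingraph.orbit -orderSpred /=.
by rewrite eqxx.
Qed.

Lemma pos_fixed_orbit f x :
  s f = f -> f != ord_max -> fconnect s ord_max x -> pos f < pos x.
Proof.
move=> sf fN Nx; rewrite pos_fixed // pos_orbit //; apply: ltn_addr.
by rewrite index_mem mem_small_fixed sf eqxx fN.
Qed.

Lemma pos_fixed_fixed f g :
  s f = f -> s g = g -> g != ord_max -> f < g -> pos f < pos g.
Proof.
move=> sf sg gN fg.
have fN : f != ord_max by rewrite -(inj_eq val_inj) /=; move: (ltn_ord g); lia.
rewrite !pos_fixed //.
have Fs : sorted (relpre val ltn) small_fixed.
  apply: sorted_filter => [y x z /=|]; first exact: ltn_trans.
  by rewrite -(sorted_map (f := val)) val_enum_ord iota_ltn_sorted.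
have fF : f \in small_fixed by rewrite mem_small_fixed sf eqxx.
have gF : g \in small_fixed by rewrite mem_small_fixed sg eqxx.
rewrite ltnNge leq_eqVlt; apply/norP; split.
  apply: contraTneq fg => /(congr1 (nth f small_fixed)).
  by rewrite !nth_index // => ->; rewrite ltnn.
have tr : transitive (relpre (val : 'I_N.+1 -> nat) ltn).
  by move=> y x z /=; apply: ltn_trans.
by apply/negP => /(sorted_ltn_index tr Fs _ _ gF fF) /=; rewrite ltnNge ltnW.
Qed.

(** Within the last block, the position of a letter is the exponent that reaches it from N;
    [s x != ord_max] rules out the wrap-around. *)
Lemma pos_succ x :
  fconnect s ord_max x -> s x != ord_max -> pos (s x) = (pos x).+1 :> nat.
Proof.
move=> Nx sxN; have Nsx : fconnect s ord_max (s x).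
  exact: connect_trans Nx (fconnect1 _ _).
rewrite !pos_orbit // -addnS; congr (_ + _).
have := findex_max Nx; have := iter_findex Nx.
rewrite -[index x _]/(findex s ord_max x).
rewrite -[index (s x) _]/(findex s ord_max (s x)).
move: (findex _ _ x) => i Ex iN.
have: i.+1 < fingraph.order s ord_max.
  rewrite ltn_neqAle iN andbT; apply: contraNneq sxN => E.
  by rewrite -Ex -iterS E iter_order.
by move=> lt; rewrite -Ex -iterS findex_iter.
Qed.

(** The last letter of the word closes the cycle of N. *)
Lemma theta_last : s (theta s ord_max) = ord_max.
Proof.
rewrite permE /theta_fun theta_word_one_cycle.
have /eqP := size_theta_word s.
rewrite theta_word_one_cycle size_cat size_orbit -orderSpred addnS eqSS => /eqP E.
rewrite nth_cat -[X in X < _]E ltnNge leq_addr /= -[X in X - _]E addKn.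
rewrite /fingraph.orbit.
by rewrite nth_traject -?iterS ?orderSpred // iter_order.
Qed.

End OneCycle.

Lemma pos_neq s x y : x != y -> (s^-1)%g x != (s^-1)%g y :> nat.
Proof. by move=> xy; rewrite val_eqE (inj_eq (@perm_inj _ _)). Qed.

(** Serves to confine the cycle of N to an explicit set closed under s. *)
Lemma fconnect_sub (A : pred 'I_N.+1) s x y :
  (forall z, A z -> A (s z)) -> A x -> fconnect s x y -> A y.
Proof.
move=> sA Ax xy; rewrite -(iter_findex xy).
by elim: findex => //= k; apply: sA.
Qed.

Lemma one_cycle_eq_swap s : one_cycle s -> s ord0 = ord_max -> s ord_max = ord0 ->
  s = tperm ord0 ord_max.
Proof.
move=> sC s0 sN; apply/permP => x.
case: tpermP => [->|->|/eqP x0 /eqP xN] //; apply/eqP/negPn/negP => /sC Nx.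
have: x \in [:: ord0; ord_max].
  apply: (fconnect_sub (A := mem [:: ord0; ord_max]) _ _ Nx) => [z|] /=.
    by rewrite !inE => /orP[] /eqP ->; rewrite ?s0 ?sN eqxx ?orbT.
  by rewrite !inE eqxx orbT.
by rewrite !inE (negPf x0) (negPf xN).
Qed.

(** The last block begins with N, so a first letter other than N comes from the block of fixed
    points. *)
Lemma theta_first s : one_cycle s -> theta s ord0 != ord_max ->
  s (theta s ord0) = theta s ord0.
Proof.
move=> sC yN; apply/eqP/negPn/negP => /sC Ny.
have := pos_max_le sC Ny; have := pos_neq (theta s) yN.
by rewrite permK /=; lia.
Qed.

(** * Chains of 213-avoiding permutations moving 0 *)

Section Core.

Hypothesis N_gt3 : 3 < N.

Let o0N : (ord0 : 'I_N.+1) != ord_max.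
Proof. by rewrite -val_eqE /=; lia. Qed.

(* If x = s N <> 0, then x, 0, s 0 occur in this order in theta s. *)
Lemma avoids_image_max s :
  avoids p213 s -> avoids p213 (theta s) ->
  s ord0 != ord0 -> s ord0 != ord_max -> s ord_max = ord0.
Proof.
move=> av av1 s00 s0N; have sC := theta_avoids_one_cycle av1.
have N0 : fconnect s ord_max ord0 := sC _ s00.
apply/eqP/negPn/negP => sN0.
have sNN : s ord_max != ord_max.
  apply: contra_neq o0N => sNN; move: N0; rewrite fconnect_orbit orbit_fix //.
  by rewrite inE => /eqP.
have p0 : 0 < (s^-1)%g ord0.
  by have := pos_neq s s00; rewrite permK /=; lia.
have pN : (s^-1)%g ord0 < N.
  have := pos_neq s sN0; rewrite permK /=; have := ltn_ord ((s^-1)%g ord0); lia.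
(* Otherwise the letters [s ord0], 0, [s ord_max] of s form 213. *)
have xlt : s ord_max < s ord0.
  have xne : (s ord_max : nat) != s ord0.
    by rewrite val_eqE (inj_eq (@perm_inj _ _)) eq_sym.
  have := avoids213P _ av ord0 ((s^-1)%g ord0) ord_max p0 pN.
  by rewrite permKV /=; move: s00; rewrite -val_eqE /=; lia.
have pos1 := pos_succ sC (connect0 _ _) sNN.
have pos2 := pos_succ sC N0 s0N.
have pos3 := pos_max_le sC N0.
have := pos_neq (theta s) o0N; have := pos_neq (theta s) sN0.
move=> ne1 ne2.
apply: (avoids213_pos av1 (x := s ord_max) (y := ord0) (z := s ord0)) => //=.
- by lia.
- by lia.
by move: sN0; rewrite -val_eqE /=; lia.
Qed.

(** If [theta s] began with a fixed point of s, the previous lemma applied to [theta s] would make 0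
    its last letter, and [theta_last] would give s 0 = N. So the word begins with N, followed by s N
    = 0. *)
Lemma avoids_theta_start s :
  avoids p213 s -> avoids p213 (theta s) -> avoids p213 (theta (theta s)) ->
  s ord0 != ord0 -> s ord0 != ord_max ->
  theta s ord0 = ord_max /\ ((theta s)^-1)%g ord0 = 1 :> nat.
Proof.
move=> av av1 av2 s00 s0N; have sC := theta_avoids_one_cycle av1.
have sN := avoids_image_max av av1 s00 s0N.
have t0 : theta s ord0 = ord_max.
  apply/eqP/negPn/negP => t0N; have sf := theta_first sC t0N.
  have t00 : theta s ord0 != ord0 by apply: contraNneq s00 => E; rewrite -{1}E sf E.
  have tN := avoids_image_max av1 av2 t00 t0N.
  by have := theta_last sC; rewrite tN => E; rewrite E eqxx in s0N.
split=> //; have := pos_succ sC (connect0 _ ord_max); rewrite sN => -> //.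
by rewrite -t0 permK.
Qed.

Lemma theta_image_max s : one_cycle s -> s ord0 = ord_max -> theta s ord_max = ord0.
Proof. by move=> sC s0; apply: (@perm_inj _ s); rewrite theta_last. Qed.

(** Since s sends 1 to 0 and 0 to N, the cycle of N ends with 1, 0. *)
Lemma theta_penult s : one_cycle s -> s ord0 = ord_max ->
  (s^-1)%g ord0 = 1 :> nat -> theta s (inord N.-1) = inord 1.
Proof.
move=> sC s0 p1.
have s1 : s (inord 1) = ord0.
  rewrite -(permKV s ord0); congr (s _); apply: val_inj.
  by rewrite /= p1 inordK //; lia.
have N1 : fconnect s ord_max (inord 1).
  by apply: sC; rewrite s1 -val_eqE /= inordK //; lia.
have := pos_succ sC N1; rewrite s1 o0N => /(_ isT).
rewrite -{1}(theta_image_max sC s0) permK /= => E.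
rewrite -[RHS](permKV (theta s)); congr (theta s _); apply: val_inj.
by rewrite /= inordK; lia.
Qed.

(** Here t = [theta s] begins with a fixed point f of s. Supposing x = s N is not 0, the word t is
    shown to begin f, N, x with x < f = N - 1, and s 1 = 0 follows; this determines the cycle of N
    in t, and [theta t] then contains 213. *)
Lemma avoids2_eq_swap s :
  avoids p213 s -> avoids p213 (theta s) -> avoids p213 (theta (theta s)) ->
  s ord0 = ord_max -> theta s ord0 != ord_max -> s = tperm ord0 ord_max.
Proof.
move=> av av1 av2 s0 fN.
have sC := theta_avoids_one_cycle av1; have tC := theta_avoids_one_cycle av2.
apply: (one_cycle_eq_swap sC s0); apply/eqP/negPn/negP => x0.
set t := theta s in fN av1 av2 tC *.
have sf := theta_first sC fN.
rewrite -/t in sf; set f := t ord0 in fN sf *.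
have tN : t ord_max = ord0 := theta_image_max sC s0.
have f0 : f != ord0 by apply: contraNneq o0N => E; rewrite -s0 -E sf.
set x := s ord_max in x0.
have xN : x != ord_max by rewrite -s0 (inj_eq (@perm_inj _ _)) eq_sym.
have v1 : (inord 1 : 'I_N.+1) = 1 :> nat by rewrite inordK //; lia.
have v2 : (inord 2 : 'I_N.+1) = 2 :> nat by rewrite inordK //; lia.
have xltN : x < N by have := ltn_ord x; move: xN; rewrite -val_eqE /=; lia.
have fltN : f < N by have := ltn_ord f; move: fN; rewrite -val_eqE /=; lia.
have f_gt0 : 0 < f by move: f0; rewrite -val_eqE /=; lia.
have x_gt0 : 0 < x by move: x0; rewrite -val_eqE /=; lia.
have p0 : 0 < (s^-1)%g ord0.
  by have := pos_neq s o0N; rewrite -s0 permK /=; lia.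
have pN : (s^-1)%g ord0 < N.
  have := pos_neq s x0; rewrite permK /=; have := ltn_ord ((s^-1)%g ord0); lia.
(* If s fixed 1, its letters 1, 0, x would form 213, since x would exceed 1. *)
have s1 : s (inord 1) != inord 1.
  apply/eqP => E1.
  have p1 : 1 < (s^-1)%g ord0.
    have : inord 1 != ord0 :> 'I_N.+1 by rewrite -val_eqE /= v1.
    move/(pos_neq s); rewrite -{1}E1 permK v1; lia.
  have := avoids213P _ av (inord 1) ((s^-1)%g ord0) ord_max.
  rewrite v1 permKV E1 v1 => /(_ p1 pN isT); rewrite -/x => xle.
  have : inord 1 != x :> 'I_N.+1.
    by rewrite -E1 (inj_eq (@perm_inj _ _)) -val_eqE /= v1; lia.
  by rewrite -val_eqE /= v1; lia.
have f_gt1 : 1 < f.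
  have : f != inord 1 by apply: contraNneq s1 => <-; rewrite sf.
  by rewrite -val_eqE /= v1; lia.
have t0C : fconnect t ord_max ord0 by rewrite -tN; exact: fconnect1.
(* The cycle of N in t begins N, 0, f, so these letters are consecutive in [theta t]. *)
have tpos0 : ((theta t)^-1)%g ord0 = (((theta t)^-1)%g ord_max).+1 :> nat.
  by rewrite -{1}tN (pos_succ tC) // tN.
have tposf : ((theta t)^-1)%g f = (((theta t)^-1)%g ord_max).+2 :> nat.
  by rewrite /f (pos_succ tC) // tpos0.
have posf : (t^-1)%g f = 0 :> nat by rewrite permK.
(* A second fixed point y of s would give the pattern f, 1, y in theta t. *)
have t1 : t (inord 1) = ord_max.
  apply/eqP/negPn/negP => yN; set y := t (inord 1) in yN.
  have posy : (t^-1)%g y = 1 :> nat by rewrite permK v1.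
  have sy : s y = y.
    apply/eqP/negPn/negP => /sC Ny.
    have := pos_max_le sC Ny; rewrite -/t.
    by move: (pos_neq t yN) (pos_neq t fN) posy posf; clear; lia.
  have fy : f < y.
    have : f != y by rewrite (inj_eq (@perm_inj _ _)) -val_eqE /= v1.
    case: (ltngtP f y) => // [yf|/val_inj ->]; last by rewrite eqxx.
    by have := pos_fixed_fixed sC sy sf fN yf; rewrite -/t posy posf.
  have y1 : y != inord 1 by apply: contraNneq s1 => <-; rewrite sy.
  have N1 : fconnect t ord_max (inord 1) by exact: tC.
  have := pos_succ tC N1 yN; rewrite -/y => tposy.
  have n1 : inord 1 != ord_max :> 'I_N.+1.
    by rewrite -val_eqE /= v1; move: N_gt3; clear; lia.
  have n2 : inord 1 != ord0 :> 'I_N.+1 by rewrite -val_eqE /= v1.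
  have n3 : inord 1 != f by rewrite -val_eqE /= v1 neq_ltn f_gt1.
  apply: (avoids213_pos av2 (x := f) (y := inord 1) (z := y)) => //.
  - move: (pos_max_le tC N1) tpos0 tposf (pos_neq (theta t) n1).
    by move: (pos_neq (theta t) n2) (pos_neq (theta t) n3); clear; lia.
  - by rewrite tposy.
  - by rewrite v1.
have posN : (t^-1)%g ord_max = 1 :> nat by rewrite -t1 permK v1.
have posx : (t^-1)%g x = 2 :> nat.
  by rewrite (pos_succ sC (connect0 _ _) xN) -/t posN.
have fx : f != x by rewrite -sf (inj_eq (@perm_inj _ _)).
(* If f < x, then s^-1 stabilises [0, f), which contains 0 but not N. *)
have xf : x < f.
  case: (ltngtP x f) => // [fltx|/val_inj E]; last by rewrite E eqxx in fx.
  have sV v : s v < f -> v < f.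
    move=> svf; rewrite ltnNge; apply/negP => fv.
    have fv' : f < v.
      rewrite ltn_neqAle fv andbT val_eqE; apply: contraTneq svf => <-.
      by rewrite sf ltnn.
    have vN : v < N.
      have := ltn_ord v; have : v != ord_max.
        by apply: contraTneq svf => ->; rewrite -leqNgt ltnW.
      by rewrite -val_eqE /=; clear; lia.
    have := avoids213P _ av f v ord_max fv' vN; rewrite sf -/x => /(_ svf).
    by rewrite fltx.
  have N0 : fconnect s ord0 ord_max by rewrite -s0 fconnect1.
  rewrite fconnect_sym in N0; last exact: perm_inj.
  have : (ord_max : 'I_N.+1) < f.
    have : iter (findex s ord_max ord0) s ord_max < f by rewrite iter_findex.
    by elim: (findex _ _ _) => //= k IHk /sV.
  by rewrite /= ltnNge ltnW.
(* If f < N - 1, the letter f + 1 comes after f, N, x in t, and f, x, f + 1 form 213. *)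
have fE : f = N.-1 :> nat.
  apply/eqP/negPn/negP => fne.
  have vy : (inord f.+1 : 'I_N.+1) = f.+1 :> nat by rewrite inordK // ltnS.
  have n1 : inord f.+1 != f by rewrite -val_eqE /= vy neq_ltn ltnSn orbT.
  have n2 : inord f.+1 != ord_max :> 'I_N.+1.
    by rewrite -val_eqE /= vy; move: fne fltN; clear; lia.
  have n3 : inord f.+1 != x by rewrite -val_eqE /= vy neq_ltn ltnS (ltnW xf) orbT.
  apply: (avoids213_pos av1 (x := f) (y := x) (z := inord f.+1)) => //.
  - by rewrite posf posx.
  - move: (pos_neq t n1) (pos_neq t n2) (pos_neq t n3) posf posN posx.
    by clear; lia.
  - by rewrite vy.
(* Otherwise 0 lies between the places 1 and f of s, and s 1, 0, f form 213: s 1 differs from N and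
   from f = N - 1, hence is smaller than f. *)
have p1 : (s^-1)%g ord0 = 1 :> nat.
  apply/eqP/negPn/negP => p1.
  have pf : (s^-1)%g ord0 < f.
    move: (pos_neq s f0); rewrite -{1}sf permK; move: fE pN; clear; lia.
  have u0 : s (inord 1) != ord0.
    by apply: contraNneq p1 => <-; rewrite permK v1.
  have uN : s (inord 1) != ord_max.
    by rewrite -s0 (inj_eq (@perm_inj _ _)) -val_eqE /= v1.
  have uf : s (inord 1) != f.
    by rewrite -sf (inj_eq (@perm_inj _ _)) -val_eqE /= v1 neq_ltn f_gt1.
  have := avoids213P _ av (inord 1) ((s^-1)%g ord0) f.
  rewrite v1 permKV sf => /(_ _ pf); move: u0 uN uf; rewrite -!val_eqE /=.
  by move: (ltn_ord (s (inord 1))) p0 p1 fE; clear; lia.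
have tf : t f = inord 1.
  rewrite -(theta_penult sC s0 p1); congr (t _); apply: val_inj.
  by rewrite /= fE inordK // ltnS leq_pred.
(* Now t has the cycle N, 0, N-1, 1, and the pattern in theta t is 2, 0, N-1. *)
have t2 : t (inord 2) = inord 2.
  apply/eqP/negPn/negP => /tC N2.
  have : inord 2 \in [:: ord_max; ord0; f; inord 1].
    apply: (fconnect_sub (A := mem [:: ord_max; ord0; f; inord 1]) _ _ N2) => [z|] /=.
      rewrite !inE => /or4P[] /eqP ->; by rewrite ?tN ?tf ?t1 ?eqxx ?orbT.
    by rewrite inE eqxx.
  by rewrite !inE -!val_eqE /= v1 v2 fE; move: N_gt3; clear; lia.
have n2 : inord 2 != ord_max :> 'I_N.+1.
  by rewrite -val_eqE /= v2; move: N_gt3; clear; lia.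
apply: (avoids213_pos av2 (x := inord 2) (y := ord0) (z := f)).
- exact: pos_fixed_orbit.
- by rewrite tposf tpos0.
- by rewrite v2.
- by rewrite v2 fE; move: N_gt3; clear; lia.
Qed.

(** If s 0 = N, either [theta s] also begins with N, and then it exchanges 0 and N, or
    [avoids2_eq_swap] applies to s. The case s 0 <> N is contradictory. *)
Lemma avoids3_eq_swap s :
  avoids p213 s -> avoids p213 (theta s) -> avoids p213 (theta (theta s)) ->
  avoids p213 (theta (theta (theta s))) -> s ord0 != ord0 ->
  s = tperm ord0 ord_max \/ theta s = tperm ord0 ord_max.
Proof.
move=> av av1 av2 av3 s00.
have sC := theta_avoids_one_cycle av1; have tC := theta_avoids_one_cycle av2.
have uC := theta_avoids_one_cycle av3.
have [s0|s0] := eqVneq (s ord0) ord_max.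
  have [t0|t0] := eqVneq (theta s ord0) ord_max.
    by right; apply: one_cycle_eq_swap => //; apply: theta_image_max.
  by left; apply: avoids2_eq_swap.
(* Now [theta s] begins N, 0, so its image under theta sends N - 1 to 1 and cannot be the
   transposition (0 N); nor can [theta s], whose inverse sends 0 to 1. *)
have [t0 tp] := avoids_theta_start av av1 av2 s00 s0.
have v1 : (inord 1 : 'I_N.+1) = 1 :> nat by rewrite inordK //; lia.
have vN : (inord N.-1 : 'I_N.+1) = N.-1 :> nat by rewrite inordK //; lia.
have n1 : inord N.-1 != inord 1 :> 'I_N.+1 by rewrite -val_eqE /= v1 vN; lia.
have n0 : ord0 != inord N.-1 :> 'I_N.+1 by rewrite -val_eqE /= vN; lia.
have nN : ord_max != inord N.-1 :> 'I_N.+1 by rewrite -val_eqE /= vN; lia.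
have uN := theta_penult tC t0 tp.
have [u0|u0] := eqVneq (theta (theta s) ord0) ord_max.
  have E := one_cycle_eq_swap uC u0 (theta_image_max tC t0).
  by move: uN; rewrite E tpermD // => E'; rewrite E' eqxx in n1.
have E := avoids2_eq_swap av1 av2 av3 t0 u0.
by move: tp; rewrite E tpermV tpermL /=; lia.
Qed.

End Core.

End Theta.

(** * The orbit of the transposition (0 N) *)

Section Swap.

Variable N : nat.
Implicit Types (s t : 'S_N.+1) (x y : 'I_N.+1).

(** A word beginning with N has no block of fixed points before it: it is one cycle, and s sends
    each letter to the next. *)
Lemma theta_succ s (i j : 'I_N.+1) : one_cycle s -> theta s ord0 = ord_max ->
  j = i.+1 :> nat -> s (theta s i) = theta s j.
Proof.
move=> sC t0 ij.
have pN : ((theta s)^-1)%g ord_max = 0 :> nat by rewrite -t0 permK.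
have iN : i != ord_max by rewrite -val_eqE /=; have := ltn_ord j; lia.
have Ni : fconnect s ord_max (theta s i).
  have [->|tiN] := eqVneq (theta s i) ord_max; first exact: connect0.
  apply: (sC); apply/eqP => sx.
  by have := pos_fixed_orbit sC sx tiN (connect0 _ _); rewrite pN.
have siN : s (theta s i) != ord_max.
  by rewrite -(theta_last sC) !(inj_eq (@perm_inj _ _)).
have := pos_succ sC Ni siN; rewrite permK -ij => /val_inj <-.
by rewrite permKV.
Qed.

(** With N in front, s can be read off the word: each letter goes to the next one and the last to
    N. *)
Lemma theta_inj_max s t : one_cycle s -> one_cycle t ->
  theta s = theta t -> theta s ord0 = ord_max -> s = t.
Proof.
move=> sC tC st s0; apply/permP => x.
rewrite -(permKV (theta s) x); set i := ((theta s)^-1)%g x.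
have [->|iN] := eqVneq i ord_max.
  by rewrite theta_last // st theta_last.
have ji : i.+1 < N.+1.
  by have := ltn_ord i; move: iN; rewrite -val_eqE /=; lia.
rewrite (theta_succ (j := Ordinal ji)) // [in RHS]st.
by rewrite (theta_succ (j := Ordinal ji)) -?st.
Qed.

(** The function g lists the cycle of N starting from N; as it reaches every value, s is a full
    cycle and g is its word. *)
Lemma theta_full s (g : nat -> nat) :
  g 0 = N ->
  (forall x (i : nat), i < N -> x = g i :> nat -> s x = g i.+1 :> nat) ->
  (forall x, exists2 i, i <= N & x = g i :> nat) ->
  one_cycle s /\ forall i, theta s i = g i :> nat.
Proof.
move=> g0 gS gsurj.
have gE i : i <= N -> iter i s ord_max = g i :> nat.
  by elim: i => [|i IHi] iN; rewrite ?g0 //= (gS _ i) // IHi // ltnW.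
have sC : one_cycle s.
  move=> x _; have [i iN xi] := gsurj x.
  rewrite (_ : x = iter i s ord_max) ?fconnect_iter //.
  by apply: val_inj; rewrite /= xi gE.
have s0 : theta s ord0 = ord_max.
  apply/eqP/negPn/negP => fN; have := theta_first sC fN.
  have [i iN xi] := gsurj (theta s ord0) => sf.
  have {}xi : iter i s ord_max = theta s ord0 by apply: val_inj; rewrite /= gE.
  (* A fixed point of the form s^i N equals N, by cancelling s^i. *)
  have: iter i s ord_max = iter i s (theta s ord0).
    by rewrite xi; elim: {gE gS iN xi}i => //= i <-.
  elim: {xi iN} i => [E0|i IHi /= /(@perm_inj _ s) /IHi //].
  by rewrite /= in E0; rewrite -E0 eqxx in fN.
split=> // i; rewrite -gE; last by rewrite -ltnS.
congr nat_of_ord.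
case: i => i /=; elim: i => [|i IHi] iN.
  by rewrite -s0; congr (theta s _); apply: val_inj.
by rewrite iterS -(IHi (ltnW iN)) (theta_succ (j := Ordinal iN)).
Qed.

(** Turns avoidance into arithmetic on a closed formula, to be settled by cases. *)
Lemma avoids_fun s (g : nat -> nat) : (forall x, s x = g x :> nat) ->
  (forall i j k, i < j -> j < k -> k <= N -> g j < g i -> ~~ (g i < g k)) ->
  avoids p213 s.
Proof.
move=> sg gP; apply/avoids213P => i j k ij jk; rewrite !sg; apply: gP => //.
by rewrite -ltnS.
Qed.

Hypothesis N_gt3 : 3 < N.

Let E : 'S_N.+1 := tperm ord0 ord_max.

Lemma swapE x :
  E x = (if x == 0 :> nat then N else if x == N :> nat then 0 else x) :> nat.
Proof.
rewrite /E; case: tpermP => [->|->|/eqP x0 /eqP xN] /=; first by [].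
  by rewrite eqxx; case: eqVneq.
rewrite -(val_eqE _ ord0) -(val_eqE _ ord_max) /= in x0 xN *.
by rewrite (negPf x0) (negPf xN).
Qed.

Lemma one_cycle_swap : one_cycle E.
Proof.
move=> x; rewrite /E; case: tpermP => [-> _|-> _|]; rewrite ?eqxx //.
by rewrite -[X in fconnect _ _ X](tpermR ord0 ord_max) fconnect1.
Qed.

(** The word consists of the fixed points 1, .., N - 1 followed by the cycle N, 0. *)
Lemma theta_swapE x : theta E x = (if x < N then x.+1 else 0) :> nat.
Proof.
have orbE : fingraph.orbit E ord_max = [:: ord_max; ord0].
  have E1 : E ord_max = ord0 by rewrite /E tpermR.
  rewrite /fingraph.orbit (_ : fingraph.order E ord_max = 2) /= ?E1 //.
  apply: (@order_cycle _ E [:: ord_max; ord0]).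
  - by rewrite /= E1 /E tpermL !eqxx.
  - by rewrite /= inE -val_eqE /=; lia.
  - by rewrite inE eqxx.
have fixE : map val (small_fixed E) = iota 1 N.-1.
  apply: (irr_sorted_eq ltn_trans ltnn).
  - rewrite sorted_map; apply: sorted_filter => [y z t /=|]; first exact: ltn_trans.
    by rewrite -(sorted_map (f := val)) val_enum_ord iota_ltn_sorted.
  - exact: iota_ltn_sorted.
  move=> y; rewrite mem_iota; apply/mapP/idP => [[z]|y1].
    rewrite mem_small_fixed -!val_eqE /= swapE => zP ->.
    by move: zP; have := ltn_ord z; do ?[case: ifP]; lia.
  have yN : y < N.+1 by lia.
  exists (Ordinal yN) => //; rewrite mem_small_fixed -!val_eqE /= swapE /=.
  by do ?[case: ifP]; lia.
have wE : map val (theta_word E) = rcons (iota 1 N) 0.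
  rewrite (theta_word_one_cycle one_cycle_swap) orbE map_cat fixE /=.
  have {3}-> : N = N.-1 + 1 by lia.
  by rewrite iotaD -cats1 -catA /=; congr (_ ++ [:: _; _]); lia.
rewrite permE /theta_fun -[LHS](nth_map x 0 val) ?size_theta_word // wE.
rewrite nth_rcons size_iota; case: ltnP => xN; first by rewrite nth_iota.
by case: eqP.
Qed.

(** [theta E] is the full cycle N, 0, 1, .., N - 1. *)
Lemma theta2_swapE x : theta (theta E) x = (if x == 0 :> nat then N else x.-1) :> nat.
Proof.
have [//||z|_ ->] // := @theta_full (theta E) (fun i => if i == 0 then N else i.-1).
  move=> y i iN; rewrite theta_swapE /=; do ?[case: ifP]; lia.
exists (if z == N :> nat then 0 else z.+1); have := ltn_ord z;
  do ?[case: ifP]; lia.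
Qed.

(** [theta (theta E)] is the full cycle N, N - 1, .., 0. *)
Lemma theta3_swapE x : theta (theta (theta E)) x = N - x :> nat.
Proof.
have [||z|_ ->] // := @theta_full (theta (theta E)) (fun i => N - i).
- by rewrite subn0.
- by move=> y i iN; rewrite theta2_swapE /=; do ?[case: ifP]; lia.
by exists (N - z); have := ltn_ord z; lia.
Qed.

Lemma avoids_swap : avoids p213 E.
Proof.
pose g a := if a == 0 then N else if a == N then 0 else a.
apply: (@avoids_fun _ g swapE); rewrite /g.
by move=> i j k /=; do ?[case: ifP]; lia.
Qed.

Lemma avoids_theta_swap : avoids p213 (theta E).
Proof.
apply: (@avoids_fun _ (fun a => if a < N then a.+1 else 0) theta_swapE).
by move=> i j k /=; do ?[case: ifP]; lia.
Qed.

Lemma avoids_theta2_swap : avoids p213 (theta (theta E)).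
Proof.
apply: (@avoids_fun _ (fun a => if a == 0 then N else a.-1) theta2_swapE).
by move=> i j k /=; do ?[case: ifP]; lia.
Qed.

Lemma avoids_theta3_swap : avoids p213 (theta (theta (theta E))).
Proof. by apply: (@avoids_fun _ (fun a => N - a) theta3_swapE) => i j k; lia. Qed.

(** The reversal [theta (theta (theta E))] moves 1, yet its cycle through N is {0, N}: it has a
    second nontrivial cycle. *)
Lemma contains_theta4_swap : ~~ avoids p213 (theta (theta (theta (theta E)))).
Proof.
apply/negP => /theta_avoids_one_cycle sC.
have v1 : (inord 1 : 'I_N.+1) = 1 :> nat by rewrite inordK //; lia.
have /sC N1 : theta (theta (theta E)) (inord 1) != inord 1.
  by rewrite -val_eqE /= theta3_swapE v1; lia.
pose A (z : 'I_N.+1) := (z == 0 :> nat) || (z == N :> nat).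
have sA z : A z -> A (theta (theta (theta E)) z) by rewrite /A theta3_swapE; lia.
have AN : A ord_max by rewrite /A eqxx orbT.
by have := fconnect_sub sA AN N1; rewrite /A v1; lia.
Qed.

(* The preimage N 2 3 .. N-1 0 1 of the transposition (0 N) under theta. *)
Definition preswap_fun x : 'I_N.+1 :=
  inord (if x == 0 :> nat then N else if x == N :> nat then 1
         else if x == N.-1 :> nat then 0 else x.+1).

Lemma val_preswap_fun x :
  preswap_fun x = (if x == 0 :> nat then N else if x == N :> nat then 1
         else if x == N.-1 :> nat then 0 else x.+1) :> nat.
Proof. by rewrite inordK //; have := ltn_ord x; do ![case: ifP]; lia. Qed.

Lemma preswap_fun_inj : injective preswap_fun.
Proof.
move=> x y /(congr1 val) /=; rewrite !val_preswap_fun => xy; apply: val_inj.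
by move: xy; have := ltn_ord x; have := ltn_ord y; do ![case: ifP] => /=; lia.
Qed.

Definition preswap : 'S_N.+1 := perm preswap_fun_inj.

(** The cycle of N in [preswap] is N, 1, 2, .., N - 1, 0, which is the word of E. *)
Lemma theta_preswap : theta preswap = E.
Proof.
have dE x : preswap x = (if x == 0 :> nat then N else if x == N :> nat then 1
         else if x == N.-1 :> nat then 0 else x.+1) :> nat.
  by rewrite permE val_preswap_fun.
have [||z|_ H] // := @theta_full preswap
   (fun i => if i == 0 then N else if i == N then 0 else i).
- by move=> y i iN; rewrite dE /=; do ![case: ifP]; lia.
- exists (if z == N :> nat then 0 else if z == 0 :> nat then N else z);
    have := ltn_ord z; do ![case: ifP]; lia.
by apply/permP => x; apply: val_inj; rewrite /= H swapE.
Qed.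

Lemma avoids_preswap : avoids p213 preswap.
Proof.
apply: (@avoids_fun _ (fun a => if a == 0 then N else if a == N then 1
         else if a == N.-1 then 0 else a.+1)) => [x|i j k].
  by rewrite permE val_preswap_fun.
by move=> /=; do ?[case: ifP]; lia.
Qed.

End Swap.

(** * Counting *)

Fixpoint avoids_chain (n k : nat) (s : 'S_n) : bool :=
  avoids p213 s && (if k is k'.+1 then avoids_chain k' (theta s) else true).

Lemma avoids_chainP (n k : nat) (s : 'S_n) :
  [forall j : 'I_k.+1, avoids p213 (iter j (@theta n) s)] = avoids_chain k s.
Proof.
elim: k s => [|k IHk] s /=.
  rewrite andbT; apply/forallP/idP => [/(_ ord0) //|av j].
  by rewrite ord1.
rewrite -IHk; apply/forallP/andP => [av|[av /forallP av'] j].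
  split; first exact: (av ord0).
  by apply/forallP => j; have := av (lift ord0 j); rewrite lift0 iterSr.
by case: (unliftP ord0 j) => [j' ->|-> //]; rewrite lift0 iterSr.
Qed.

Lemma t_countE (n k : nat) :
  t_count p213 k n = #|[set s : 'S_n | avoids_chain k s]|.
Proof. by apply: eq_card => s; rewrite !inE avoids_chainP. Qed.

Lemma avoids_chain_leq (n k l : nat) (s : 'S_n) :
  k <= l -> avoids_chain l s -> avoids_chain k s.
Proof.
elim: k l s => [|k IHk] [|l] s //= kl /andP[-> //].
exact: IHk.
Qed.

(** * Adding a fixed point 0 *)

Section Lift.

Variable n : nat.
Let L (s : 'S_n) : 'S_n.+1 := lift_perm ord0 ord0 s.

Lemma orbit_lift s m :
  fingraph.orbit (L s) (lift ord0 m) = map (lift ord0) (fingraph.orbit s m).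
Proof.
have oE : fingraph.order (L s) (lift ord0 m) = fingraph.order s m.
  rewrite -[RHS](size_orbit s) -(size_map (lift ord0)).
  apply: (@order_cycle _ (L s)).
  - rewrite (@homo_cycle _ _ (lift ord0) (frel s)) //; last first.
      by apply: cycle_orbit; exact: perm_inj.
    by move=> x y /= /eqP <-; rewrite /L lift_perm_lift.
  - by rewrite map_inj_uniq ?orbit_uniq //; exact: lift_inj.
  - by rewrite map_f // in_orbit.
rewrite /fingraph.orbit {}oE; move: (fingraph.order s m) => k.
elim: k m => //= k IHk m.
by rewrite -IHk /L lift_perm_lift.
Qed.

(** The fixed point 0 is the smallest cycle maximum, so it comes first; the other cycles are shifted
    in the same order. *)
Lemma theta_word_lift s :
  theta_word (L s) = ord0 :: map (lift ord0) (theta_word s).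
Proof.
have L0 : fingraph.orbit (L s) ord0 = [:: ord0].
  by apply: orbit_fix; rewrite /L lift_perm_id.
rewrite /theta_word /std_cycles /cycle_maxima enum_ordSl /= L0 /= L0 /=.
congr (_ :: _); elim: (enum 'I_n) => //= m l IHl.
rewrite orbit_lift all_map.
rewrite (eq_all (a2 := fun j : 'I_n => j <= m)) => [|j];
  last by rewrite /= /bump /= !add1n ltnS.
by case: (all _ _); rewrite //= orbit_lift map_cat IHl.
Qed.

Lemma theta_lift s : theta (L s) = L (theta s).
Proof.
apply/permP => i; rewrite permE /theta_fun theta_word_lift.
case: (unliftP ord0 i) => [j ->|->] /=; last by rewrite /L lift_perm_id.
rewrite /L lift_perm_lift permE /theta_fun (nth_map j) //.
by rewrite add0n size_theta_word ltn_ord.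
Qed.

(** A leading 0 takes no part in a 213, whose first letter exceeds a later one. *)
Lemma avoids_lift s : avoids p213 (L s) = avoids p213 s.
Proof.
apply/avoids213P/avoids213P => av i j k.
  move=> ij jk; have := av (lift ord0 i) (lift ord0 j) (lift ord0 k).
  by rewrite /L !lift_perm_lift !lift0 !ltnS; apply.
case: (unliftP ord0 i) => [i' ->|->]; last by rewrite /L lift_perm_id ltn0.
case: (unliftP ord0 j) => [j' ->|-> //].
case: (unliftP ord0 k) => [k' ->|-> //].
by rewrite /L !lift_perm_lift !lift0 !ltnS; apply: av.
Qed.

Lemma avoids_chain_lift k s : avoids_chain k (L s) = avoids_chain k s.
Proof. by elim: k s => [|k IHk] s /=; rewrite avoids_lift // theta_lift IHk. Qed.

Lemma lift_perm_inj : injective L.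
Proof.
move=> s t /permP st; apply/permP => i; apply: (@lift_inj _ ord0).
by have := st (lift ord0 i); rewrite /L !lift_perm_lift.
Qed.

Lemma lift_perm_surj (t : 'S_n.+1) : t ord0 = ord0 -> exists s, t = L s.
Proof.
move=> t0; have tn0 i : {j | t (lift ord0 i) = lift ord0 j}.
  case: (unliftP ord0 (t (lift ord0 i))) => [j ->|E]; first by exists j.
  by move: E; rewrite -[RHS]t0 => /perm_inj.
have sI : injective (fun i => sval (tn0 i)).
  move=> i j; case: (tn0 i) (tn0 j) => [a Ea] [b Eb] /= ab.
  by apply: (@lift_inj _ ord0); apply: (@perm_inj _ t); rewrite Ea Eb ab.
exists (perm sI); apply/permP => i.
case: (unliftP ord0 i) => [j ->|->]; last by rewrite /L lift_perm_id.
by rewrite /L lift_perm_lift permE; case: (tn0 j).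
Qed.

Lemma t_countS k : t_count p213 k n.+1 = t_count p213 k n +
  #|[set s : 'S_n.+1 | avoids_chain k s && (s ord0 != ord0)]|.
Proof.
rewrite !t_countE -(cardsID [set s : 'S_n.+1 | s ord0 == ord0]); congr (_ + _).
  rewrite -(card_imset _ lift_perm_inj); apply: eq_card => t.
  rewrite !inE; apply/andP/imsetP => [[tk /eqP /lift_perm_surj[s Es]]|[s]].
    by exists s => //; rewrite inE -avoids_chain_lift -Es.
  by rewrite inE => sk ->; rewrite avoids_chain_lift /L lift_perm_id.
by apply: eq_card => t; rewrite !inE andbC.
Qed.

End Lift.

(** * Counting the chains that move 0 *)

Section Moving0.

Variable N : nat.
Hypothesis N_gt3 : 3 < N.

Let E : 'S_N.+1 := tperm ord0 ord_max.
Let D : 'S_N.+1 := preswap N_gt3.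
Let thetaD : theta D = E := theta_preswap N_gt3.

Lemma avoids_chain3_swap : avoids_chain 3 E.
Proof.
by rewrite /= avoids_swap // avoids_theta_swap // avoids_theta2_swap //
   avoids_theta3_swap.
Qed.

Lemma avoids_chain4_swap : ~~ avoids_chain 4 E.
Proof.
apply/negP => /and5P[_ _ _ _]; rewrite andbT.
by apply/negP; apply: contains_theta4_swap.
Qed.

Lemma avoids_chain_preswap k : avoids_chain k.+1 D = avoids_chain k E.
Proof. by rewrite /= thetaD avoids_preswap. Qed.

Lemma avoids_chain3P (s : 'S_N.+1) :
  s ord0 != ord0 -> avoids_chain 3 s = (s == E) || (s == D).
Proof.
move=> s0; apply/idP/orP => [|[]/eqP ->]; last 2 first.
- exact: avoids_chain3_swap.
- rewrite avoids_chain_preswap; exact: avoids_chain_leq avoids_chain3_swap.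
move=> /and5P[av av1 av2 av3 _].
have [sE|tE] := avoids3_eq_swap N_gt3 av av1 av2 av3 s0.
  by left; apply/eqP.
right; apply/eqP; apply: theta_inj_max.
- exact: theta_avoids_one_cycle.
- by apply: theta_avoids_one_cycle; rewrite thetaD; apply: avoids_swap.
- by rewrite thetaD.
- by rewrite tE tpermL.
Qed.

Lemma swap0 : E ord0 != ord0.
Proof. by rewrite /E tpermL -val_eqE /=; lia. Qed.

Lemma preswap0 : D ord0 != ord0.
Proof. by rewrite permE -val_eqE /= val_preswap_fun //=; lia. Qed.

(** The chain of D is that of E with one more step in front, so chains of length 4 tell them
    apart. *)
Lemma preswap_neq_swap : D != E.
Proof.
apply: contraNneq avoids_chain4_swap => DE.
by rewrite -DE avoids_chain_preswap avoids_chain3_swap.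
Qed.

Lemma card_avoids_chain3_moving0 :
  #|[set s : 'S_N.+1 | avoids_chain 3 s && (s ord0 != ord0)]| = 2.
Proof.
rewrite -[RHS](_ : #|[set D; E]| = 2); last by rewrite cards2 preswap_neq_swap.
apply: eq_card => s; rewrite !inE; have [s0|s0] := boolP (s ord0 != ord0).
  by rewrite andbT avoids_chain3P // orbC.
rewrite andbF; apply/esym/negP => /orP[]/eqP Es; move: s0; rewrite Es.
  by rewrite preswap0.
by rewrite swap0.
Qed.

Lemma card_avoids_chain4_moving0 :
  #|[set s : 'S_N.+1 | avoids_chain 4 s && (s ord0 != ord0)]| = 1.
Proof.
rewrite -[RHS](cards1 D); apply: eq_card => s; rewrite !inE.
have [->|sD] := eqVneq s D.
  by rewrite avoids_chain_preswap avoids_chain3_swap preswap0.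
apply/negP => /andP[s4 s0]; have := avoids_chain_leq (leqnSn 3) s4.
rewrite avoids_chain3P // (negPf sD) orbF => /eqP sE.
by move: s4; rewrite sE (negPf avoids_chain4_swap).
Qed.

Lemma card_avoids_chain5_moving0 k : 5 <= k ->
  #|[set s : 'S_N.+1 | avoids_chain k s && (s ord0 != ord0)]| = 0.
Proof.
move=> k5; apply/eqP; rewrite cards_eq0 -subset0; apply/subsetP => s.
rewrite !inE => /andP[/(avoids_chain_leq k5) s5 s0].
have := avoids_chain_leq (leqW (leqnSn 3)) s5.
rewrite avoids_chain3P // => /orP[]/eqP sE; move: s5; rewrite sE.
  by move/(avoids_chain_leq (leqnSn 4)); rewrite (negPf avoids_chain4_swap).
by rewrite avoids_chain_preswap (negPf avoids_chain4_swap).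
Qed.

End Moving0.

(** * Evaluation on words *)

Definition word (n : nat) (s : 'S_n) : seq nat :=
  [seq nat_of_ord (s i) | i <- enum 'I_n].

(** An executable orbit: the iterates starting at the image of m are listed for [size w] steps,
    enough to return to m, and cut at the first return. *)
Definition word_cycle (w : seq nat) (m : nat) : seq nat :=
  let t := traject (nth 0 w) (nth 0 w m) (size w) in m :: take (index m t) t.

Definition word_theta (w : seq nat) : seq nat :=
  flatten [seq word_cycle w m | m <- iota 0 (size w) &
             all (fun j => j <= m) (word_cycle w m)].

Definition word_avoids (w : seq nat) : bool :=
  all (fun k => all (fun j => all (fun i =>
      (nth 0 w j < nth 0 w i) ==> ~~ (nth 0 w i < nth 0 w k))
    (iota 0 j)) (iota 0 k)) (iota 0 (size w)).

Fixpoint word_chain (k : nat) (w : seq nat) : bool :=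
  word_avoids w && (if k is k'.+1 then word_chain k' (word_theta w) else true).

Section Word.

Variable n : nat.
Implicit Types (s : 'S_n) (i m : 'I_n).

Lemma size_word s : size (word s) = n.
Proof. by rewrite size_map size_enum_ord. Qed.

Lemma nth_word s i : nth 0 (word s) i = s i.
Proof.
by rewrite (nth_map i) ?size_enum_ord // nth_ord_enum.
Qed.

Lemma orbit_take s m : let t := traject s (s m) n in
  fingraph.orbit s m = m :: take (index m t) t.
Proof.
have := max_card (fconnect s m); rewrite card_ord.
rewrite -/(fingraph.order s m) /fingraph.orbit.
have := orbit_uniq s m; rewrite /fingraph.orbit.
have := iter_order (@perm_inj _ s) m.
rewrite -orderSpred /= -iterS iterSr; set k := _.-1 => km /andP[mk _] kn.
(* Here k is the length of the cycle minus one, so m first reappears after k letters; k < n keeps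
   this within the n steps. *)
have -> : traject s (s m) n = traject s (s m) (k + (n - k).-1.+1).
  by congr traject; lia.
rewrite trajectD /= km index_cat (negPf mk) /= eqxx addn0 size_traject.
by rewrite take_size_cat // size_traject.
Qed.

Lemma word_cycleE s m : word_cycle (word s) m = map val (fingraph.orbit s m).
Proof.
have trE k i : traject (nth 0 (word s)) i k = map val (traject s i k).
  by elim: k i => //= k IHk i; rewrite nth_word IHk.
rewrite orbit_take /= /word_cycle size_word nth_word trE.
by rewrite index_map ?map_take //; exact: val_inj.
Qed.

Lemma word_theta_word s : word (theta s) = word_theta (word s).
Proof.
have -> : word (theta s) = map val (theta_word s).
  by rewrite -one_line_theta /one_line -map_comp.
rewrite /word_theta size_word -val_enum_ord /theta_word /std_cycles /cycle_maxima.
rewrite -[map val (enum _)]/(map (@nat_of_ord n) (enum 'I_n)).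
rewrite map_flatten filter_map -!map_comp; congr flatten.
rewrite (eq_map (word_cycleE s)); congr map; apply: eq_filter => m.
rewrite -[RHS]/(all (fun j => j <= m) (word_cycle (word s) m)).
by rewrite word_cycleE all_map.
Qed.

Lemma word_avoidsE s : word_avoids (word s) = avoids p213 s.
Proof.
rewrite /word_avoids size_word; apply/allP/avoids213P => [av i j k ij jk sji|av k].
  have := av k; rewrite mem_iota => /(_ (ltn_ord k)) /allP/(_ j).
  rewrite mem_iota => /(_ jk).
  by move=> /allP/(_ i); rewrite mem_iota !nth_word => /(_ ij) /implyP; apply.
rewrite mem_iota add0n /= => kn; apply/allP => j; rewrite mem_iota add0n /= => jk.
apply/allP => i; rewrite mem_iota add0n /= => ij; apply/implyP.
have jn := ltn_trans jk kn; have i_n := ltn_trans ij jn.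
have := av (Ordinal i_n) (Ordinal jn) (Ordinal kn) ij jk.
by rewrite -!nth_word.
Qed.

Lemma word_chainE k s : word_chain k (word s) = avoids_chain k s.
Proof.
by elim: k s => [|k IHk] s /=; rewrite word_avoidsE // -word_theta_word IHk.
Qed.

Lemma word_inj : injective (@word n).
Proof.
by move=> s t st; apply/permP => i; apply: val_inj; rewrite /= -!nth_word st.
Qed.

Lemma perm_words : perm_eq (map (@word n) (enum 'S_n)) (permutations (iota 0 n)).
Proof.
have ws : {subset map (@word n) (enum 'S_n) <= permutations (iota 0 n)}.
  move=> _ /mapP[s _ ->]; rewrite mem_permutations -val_enum_ord.
  rewrite /word (map_comp val s); apply: perm_map; apply: uniq_perm.
  - by rewrite map_inj_uniq ?enum_uniq //; exact: perm_inj.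
  - exact: enum_uniq.
  move=> i; rewrite mem_enum; apply/mapP; exists ((s^-1)%g i); rewrite ?permKV //.
  by rewrite mem_enum.
have wu : uniq (map (@word n) (enum 'S_n)).
  by rewrite map_inj_uniq ?enum_uniq //; exact: word_inj.
apply: uniq_perm => //; first exact: permutations_uniq.
(* Both lists have n! distinct entries, so the inclusion is an equality. *)
apply: (uniq_min_size wu ws _).2.
rewrite size_permutations ?iota_uniq // size_iota size_map -cardE.
by rewrite card_Sn.
Qed.

Lemma t_count_word k :
  t_count p213 k n = count (word_chain k) (permutations (iota 0 n)).
Proof.
rewrite t_countE -(seq.permP perm_words) count_map cardsE cardE enumT /enum_mem.
by rewrite size_filter; apply: eq_count => s; rewrite /= word_chainE.
Qed.

End Word.

(** Evaluation over all of ['S_4] shows that a chain of length 5 extends to length 6; its tail from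
    [theta s] is again of length 5, so the extension repeats indefinitely. *)
Lemma avoids_chain5 (k : nat) (s : 'S_4) :
  5 <= k -> avoids_chain k s = avoids_chain 5 s.
Proof.
have c56 (t : 'S_4) : avoids_chain 5 t -> avoids_chain 6 t.
  have /allP/(_ (word t)) : all (fun w => word_chain 5 w ==> word_chain 6 w)
      (permutations (iota 0 4)) by vm_compute.
  rewrite -(perm_mem (perm_words 4)) map_f ?mem_enum // !word_chainE.
  by move=> /(_ isT) /implyP.
move=> k5; apply/idP/idP; first exact: avoids_chain_leq.
rewrite -(subnKC k5); elim: (k - 5) s => [|d IHd] s s5; first by rewrite addn0.
have /andP[av t5] := c56 _ s5; rewrite addnS.
by apply/andP; split=> //; apply: IHd.
Qed.

Theorem theorem4p2 (n : nat) (hn : 5 <= n) :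
  [/\ t_count [:: 2; 1; 3] 3 n = 2 * n + 1,
      t_count [:: 2; 1; 3] 4 n = n + 4
    & forall k : nat, 5 <= k -> t_count [:: 2; 1; 3] k n = 7].
Proof.
have base : [/\ t_count p213 3 4 = 9, t_count p213 4 4 = 8
  & forall k, 5 <= k -> t_count p213 k 4 = 7].
  split; rewrite ?t_count_word; [by vm_compute | by vm_compute | move=> k k5].
  rewrite t_countE (eq_card (B := [set s : 'S_4 | avoids_chain 5 s])).
    by rewrite -t_countE t_count_word; vm_compute.
  by move=> s; rewrite !inE avoids_chain5.
(* The induction starts at n = 4, where the formulas already give 9, 8 and 7; each step adds the 2,
   1 or 0 permutations that move 0. *)
rewrite -(subnKC (ltnW hn)); elim: (n - 4) => [|d [IH3 IH4 IH5]].
  by case: base => -> ->.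
have N3 : 3 < 4 + d by [].
rewrite addnS; split=> [||k k5].
- by rewrite t_countS IH3 card_avoids_chain3_moving0 //; lia.
- by rewrite t_countS IH4 card_avoids_chain4_moving0 //; lia.
- by rewrite t_countS IH5 // card_avoids_chain5_moving0.
Qed.
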